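(* Let $(M,g)$, $\dim M=n\geq 4$, be an essentially conformally symmetric manifold, with Ricci tensor $S$, scalar curvature $\kappa$, Weyl conformal curvature tensor $C$ and fundamental function $F$. Then on $M$ $$\tau\, C=g\wedge S^{2}+\frac{n-2}{2}\, S\wedge S-\kappa\, g\wedge S+\frac{\kappa^{2}-\mathrm{tr}_{g}(S^{2})}{2(n-1)}\, g\wedge g,\qquad \tau=(n-2)F.$$
   Context: Manifolds are connected, paracompact, of class $C^\infty$; the metric $g$ is nondegenerate of arbitrary signature. Conventions: ${\mathcal R}(X,Y)Z=\nabla_X\nabla_YZ-\nabla_Y\nabla_XZ-\nabla_{[X,Y]}Z$, $R(X_1,X_2,X_3,X_4)=g({\mathcal R}(X_1,X_2)X_3,X_4)$, $S(X,Y)=\mathrm{tr}\{Z\mapsto{\mathcal R}(Z,X)Y\}$, $g({\mathcal S}X,Y)=S(X,Y)$, $\kappa=\mathrm{tr}\,{\mathcal S}$, $S^{2}(X,Y)=S({\mathcal S}X,Y)$. The Kulkarni-Nomizu product of symmetric $(0,2)$-tensors $A,B$ is $$(A\wedge B)(X_1,X_2,X_3,X_4)=A(X_1,X_4)B(X_2,X_3)+A(X_2,X_3)B(X_1,X_4)-A(X_1,X_3)B(X_2,X_4)-A(X_2,X_4)B(X_1,X_3),$$ and $C=R-\frac{1}{n-2}\, g\wedge S+\frac{\kappa}{2(n-2)(n-1)}\, g\wedge g$. A semi-Riemannian manifold $(M,g)$ of dimension $n\ge4$ is called essentially conformally symmetric if its Weyl conformal curvature tensor is parallel ($\nabla C=0$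 on $M$) and it is neither conformally flat nor locally symmetric. By a known theorem of Derdziński and Roter, on every such manifold there is a function $F$ with $F\, C=\frac12\, S\wedge S$; it is called the fundamental function. *)

(* Defs.v *)
(* Semi-Riemannian geometry in local coordinates: a
   manifold is a topological space with a smooth atlas modelled on 'rV[R]_n, and
   a metric is the family of its Gram matrices in the charts. *)
From mathcomp Require Import all_boot all_order all_algebra.
From mathcomp Require Import boolp classical_sets functions cardinality reals.
From mathcomp Require Import topology normedtype derive.

Set Implicit Arguments.
Unset Strict Implicit.
Unset Printing Implicit Defensive.

Import Order.TTheory GRing.Theory Num.Theory numFieldNormedType.Exports.

Local Open Scope classical_set_scope.
Local Open Scope ring_scope.

Section Smooth.
Context {R : realType} {V W : normedModType R}.

(* Meant for open [A]: the derivatives only depend on the values of [f] near a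
   point of [A], so that the values of [f] outside [A] are irrelevant. *)
Fixpoint Ck (k : nat) (A : set V) (f : V -> W) : Prop :=
  match k with
  | 0 => forall x, A x -> {for x, continuous f}
  | k'.+1 => (forall x, A x -> differentiable f x) /\
             (forall v, Ck k' A (fun x => 'D_v f x))
  end.

Definition smooth_on (A : set V) (f : V -> W) : Prop := forall k, Ck k A f.

End Smooth.

Definition paracompact_space (T : topologicalType) : Prop :=
  forall U : set (set T),
    (forall u, U u -> open u) -> (forall x, exists2 u, U u & u x) ->
  exists V : set (set T),
    [/\ forall v, V v -> open v,
        forall x, exists2 v, V v & v x,
        forall v, V v -> exists2 u, U u & v `<=` u &
        forall x : T, exists2 N : set T,
          nbhs x N & finite_set [set v | V v /\ v `&` N !=set0]].

(* [chart_inv i] is only meaningful on [chart i @` chart_dom i]. *)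
Record manifold (R : realType) (n : nat) := Manifold {
  carrier :> topologicalType;
  chart_index : Type;
  chart_dom : chart_index -> set carrier;
  chart : chart_index -> carrier -> 'rV[R]_n;
  chart_inv : chart_index -> 'rV[R]_n -> carrier;
  manifold_hausdorff : hausdorff_space carrier;
  manifold_connected : connected [set: carrier];
  manifold_paracompact : paracompact_space carrier;
  chart_cover : forall p, exists i, chart_dom i p;
  chart_dom_open : forall i, open (chart_dom i);
  chart_codom_open : forall i, open (chart i @` chart_dom i);
  chartK : forall i p, chart_dom i p -> chart_inv i (chart i p) = p;
  chart_continuous : forall i p,
    chart_dom i p -> {for p, continuous (chart i)};
  chart_inv_continuous : forall i x,
    (chart i @` chart_dom i) x -> {for x, continuous (chart_inv i)};
  chart_smooth : forall i j,
    smooth_on (chart i @` (chart_dom i `&` chart_dom j)) (chart j \o chart_inv i)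
}.

Arguments chart_dom {R n m}.
Arguments chart {R n m}.
Arguments chart_inv {R n m}.

Definition chart_codom {R n} {M : manifold R n} (i : chart_index M) :=
  chart i @` chart_dom i.

(* Curvature of a field [G] of Gram matrices in coordinates. Points, tangent
   vectors and values of vector fields are row vectors. *)
Section Local.
Context {R : realType} {n : nat}.
Local Notation V := 'rV[R]_n.

Definition gform (A : 'M[R]_n) (u v : V) : R := (u *m A *m v^T) 0 0.

(* For [A] invertible and [l] linear, the vector [w] such that
   [gform A w v = l v] for all [v]. *)
Definition riesz (A : 'M[R]_n) (l : V -> R) : V :=
  (\row_k l (delta_mx 0 k)) *m invmx A.

(* Trace of a bilinear form [B] with respect to [A]: the trace of the
   endomorphism [Q] with [gform A (Q u) v = B u v]. *)
Definition trg (A : 'M[R]_n) (B : V -> V -> R) : R :=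
  \tr (lin1_mx (fun u => riesz A (B u))).

Definition kulkarni_nomizu (A B : V -> V -> R) (u1 u2 u3 u4 : V) : R :=
  A u1 u4 * B u2 u3 + A u2 u3 * B u1 u4 - A u1 u3 * B u2 u4 - A u2 u4 * B u1 u3.

Variable G : V -> 'M[R]_n.

(* Koszul's formula for constant (coordinate) vector fields [u], [v]. *)
Definition christoffel (x u v : V) : V :=
  riesz (G x) (fun w =>
    2^-1 * ('D_u (fun y => gform (G y) v w) x
            + 'D_v (fun y => gform (G y) u w) x
            - 'D_w (fun y => gform (G y) u v) x)).

(* The Levi-Civita connection. *)
Definition nabla (X Y : V -> V) : V -> V :=
  fun x => 'D_(X x) Y x + christoffel x (X x) (Y x).

Definition lie_bracket (X Y : V -> V) : V -> V :=
  fun x => 'D_(X x) Y x - 'D_(Y x) X x.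

Definition curvature_operator (X Y Z : V -> V) : V -> V :=
  fun x => nabla X (nabla Y Z) x - nabla Y (nabla X Z) x
           - nabla (lie_bracket X Y) Z x.

(* A tensor is evaluated at tangent vectors by extending these to constant
   vector fields; by tensoriality any other smooth extension gives the same
   value. *)
Definition curvature_at (x u v w : V) : V :=
  curvature_operator (cst u) (cst v) (cst w) x.

Definition riemann (x u1 u2 u3 u4 : V) : R :=
  gform (G x) (curvature_at x u1 u2 u3) u4.

Definition ricci (x u v : V) : R :=
  \tr (lin1_mx (fun z => curvature_at x z u v)).

Definition ricci_operator (x u : V) : V := riesz (G x) (ricci x u).

Definition scalar_curvature (x : V) : R := \tr (lin1_mx (ricci_operator x)).

Definition ricci2 (x u v : V) : R := ricci x (ricci_operator x u) v.

Definition weyl (x u1 u2 u3 u4 : V) : R :=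
  riemann x u1 u2 u3 u4
  - 1 / (n%:R - 2) * kulkarni_nomizu (gform (G x)) (ricci x) u1 u2 u3 u4
  + scalar_curvature x / (2 * (n%:R - 2) * (n%:R - 1))
    * kulkarni_nomizu (gform (G x)) (gform (G x)) u1 u2 u3 u4.

(* [(nabla_u T)(u1, u2, u3, u4)] at [x], for a (0,4)-tensor field [T]. *)
Definition nabla_tensor (T : V -> V -> V -> V -> V -> R)
    (x u u1 u2 u3 u4 : V) : R :=
  let N v := nabla (cst u) (cst v) x in
  'D_u (fun y => T y u1 u2 u3 u4) x
  - T x (N u1) u2 u3 u4 - T x u1 (N u2) u3 u4
  - T x u1 u2 (N u3) u4 - T x u1 u2 u3 (N u4).

End Local.

Record semi_riemannian_metric (R : realType) (n : nat) (M : manifold R n) :=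
  SemiRiemannianMetric {
  gram :> chart_index M -> 'rV[R]_n -> 'M[R]_n;
  gram_smooth : forall i, smooth_on (chart_codom i) (gram i);
  gram_sym : forall i x, chart_codom i x -> (gram i x)^T = gram i x;
  gram_nondegenerate : forall i x, chart_codom i x -> gram i x \in unitmx;
  gram_change : forall i j p, chart_dom i p -> chart_dom j p ->
    let phi := chart j \o chart_inv i in
    forall u v, gform (gram i (chart i p)) u v
      = gform (gram j (chart j p)) ('D_u phi (chart i p)) ('D_v phi (chart i p))
}.

Section Global.
Context {R : realType} {n : nat} {M : manifold R n}.
Implicit Types (g : semi_riemannian_metric M) (f F : M -> R).

Definition parallel_weyl g : Prop :=
  forall i x, chart_codom i x ->
  forall u u1 u2 u3 u4, nabla_tensor (g i) (weyl (g i)) x u u1 u2 u3 u4 = 0.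

Definition locally_symmetric g : Prop :=
  forall i x, chart_codom i x ->
  forall u u1 u2 u3 u4, nabla_tensor (g i) (riemann (g i)) x u u1 u2 u3 u4 = 0.

(* Every point has a neighbourhood on which some conformal rescaling [f g] of
   the metric, with [f] smooth and positive, is flat. *)
Definition conformally_flat g : Prop :=
  forall p : M, exists (U : set M) (f : M -> R),
    [/\ open U, U p, forall q, U q -> 0 < f q,
        forall i, smooth_on (chart i @` (U `&` chart_dom i)) (f \o chart_inv i) &
        forall i q, U q -> chart_dom i q -> forall u1 u2 u3 u4,
          riemann (fun x => f (chart_inv i x) *: g i x) (chart i q) u1 u2 u3 u4
          = 0].

Definition essentially_conformally_symmetric g : Prop :=
  [/\ (4 <= n)%N, parallel_weyl g, ~ conformally_flat g
    & ~ locally_symmetric g].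

(* The equation [F C = 1/2 S /\ S]. *)
Definition fundamental_function g F : Prop :=
  forall i p, chart_dom i p -> forall u1 u2 u3 u4,
    F p * weyl (g i) (chart i p) u1 u2 u3 u4
    = 1 / 2 * kulkarni_nomizu (ricci (g i) (chart i p)) (ricci (g i) (chart i p))
                u1 u2 u3 u4.

End Global.

(* Main.v *)
From HB Require Import structures.
Require Import Defs.
From mathcomp Require Import all_boot all_order all_algebra perm.
From mathcomp Require Import boolp classical_sets functions reals.
From mathcomp Require Import topology normedtype derive.
From mathcomp Require Import ring.
Import GRing.Theory Num.Theory numFieldNormedType.Exports.
Local Open Scope ring_scope.

(* Every algebraic contraction of the Weyl tensor vanishes, so contracting
   F C = 1/2 S /\ S over the first and last slots leaves kappa S - S^2 = 0.
   Hence S^2 = kappa S and tr S^2 = kappa^2: all the terms of the right-hand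
   side involving g cancel, and what remains is n - 2 times the equation
   defining F. *)

(** * Linear algebra of metric contractions *)

Section Contraction.
Context {R : realType} {n : nat}.
Local Notation V := 'rV[R]_n.

Implicit Types (A : 'M[R]_n) (B P Q : V -> V -> R) (T : V -> V -> V -> V -> R).

(** Linearity is a proposition here, not a bundled structure: maps such as those given by
    [ricci G x] are only shown linear for [x] in the chart domain. *)
Lemma row_linearE (W : lmodType R) (f : V -> W) (u : V) :
  linear f -> f u = \sum_k u 0 k *: f 'e_k.
Proof.
move=> fl.
pose F : {linear V -> W} := HB.pack f (GRing.isLinear.Build _ _ _ _ f fl).
rewrite -[f]/(F : V -> W) {1}(row_sum_delta u) linear_sum.
by apply: eq_bigr => k _; rewrite linearZ.
Qed.

Lemma row_scalarE (f : V -> R) (u : V) :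
  scalar f -> f u = \sum_k u 0 k * f 'e_k.
Proof. exact: (@row_linearE R^o). Qed.

Lemma linear_addfun (W : lmodType R) (f g : V -> W) :
  linear f -> linear g -> linear (fun u => f u + g u).
Proof. by move=> fl gl a u u'; rewrite fl gl scalerDr addrACA. Qed.

Lemma linear_subfun (W : lmodType R) (f g : V -> W) :
  linear f -> linear g -> linear (fun u => f u - g u).
Proof. by move=> fl gl a u u'; rewrite fl gl scalerBr opprD addrACA. Qed.

Lemma gformE A u v : gform A u v = \sum_i \sum_j u 0 i * v 0 j * A i j.
Proof.
rewrite /gform mxE [RHS]exchange_big; apply: eq_bigr => j _.
rewrite mxE mulr_suml; apply: eq_bigr => i _.
by rewrite !mxE -!mulrA [v 0 j * _]mulrC.
Qed.

Lemma gformPl A a u u' v : gform A (a *: u + u') v = a * gform A u v + gform A u' v.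
Proof. by rewrite /gform !mulmxDl -!scalemxAl !mxE. Qed.

Lemma gformPr A a u v v' : gform A u (a *: v + v') = a * gform A u v + gform A u v'.
Proof. by rewrite /gform linearP mulmxDr -scalemxAr !mxE. Qed.

Lemma gformPm A A' a u v : gform (a *: A + A') u v = a * gform A u v + gform A' u v.
Proof.
by rewrite /gform mulmxDr mulmxDl -scalemxAr -scalemxAl !mxE.
Qed.

Lemma gform_deltar A u k : gform A u 'e_k = (u *m A) 0 k.
Proof. by rewrite /gform trmx_delta -colE mxE. Qed.

Lemma gform_rieszE A (l : V -> R) v :
  A \in unitmx -> scalar l -> gform A (riesz A l) v = l v.
Proof.
move=> uA ll; rewrite /gform /riesz mulmxKV// mxE (row_scalarE _ _ ll).
by apply: eq_bigr => k _; rewrite !mxE mulrC.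
Qed.

Lemma riesz_gform A u : A \in unitmx -> riesz A (gform A u) = u.
Proof.
move=> uA; rewrite /riesz -[RHS](mulmxK uA); congr (_ *m _).
by apply/rowP => k; rewrite mxE gform_deltar.
Qed.

(** The sum reads [B] only on basis vectors, so [trgD] and [trgZ] follow for arbitrary functions
    [B]. *)
Lemma trgE A B : trg A B = \sum_i \sum_j invmx A j i * B 'e_i 'e_j.
Proof.
rewrite /trg /mxtrace; apply: eq_bigr => i _; rewrite !mxE.
by apply: eq_bigr => j _; rewrite !mxE mulrC.
Qed.

Lemma trg_gform A : A \in unitmx -> trg A (gform A) = n%:R.
Proof.
move=> uA; rewrite /trg -(@mxtrace1 R n); congr (\tr _).
by apply/matrixP => i j; rewrite mxE riesz_gform// !mxE eqxx eq_sym.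
Qed.

Lemma trgZ A (c : R) B : trg A (fun u v => c * B u v) = c * trg A B.
Proof.
rewrite !trgE mulr_sumr; apply: eq_bigr => i _.
by rewrite mulr_sumr; apply: eq_bigr => j _; rewrite mulrCA.
Qed.

(** These are the slots whose contraction turns [riemann] into [ricci] under the sign conventions in
    force. *)
Definition contract14 A T (u v : V) : R := trg A (fun w z => T w u v z).

Lemma trgD A B B' :
  trg A (fun u v => B u v + B' u v) = trg A B + trg A B'.
Proof.
rewrite !trgE -big_split; apply: eq_bigr => i _.
by rewrite -big_split; apply: eq_bigr => j _; rewrite mulrDr.
Qed.

(** The inverse metric pairs two covectors by evaluating one at the metric dual of the other. *)
Lemma trg_prod A (l : V -> R) (l' : V -> R) : scalar l ->
  trg A (fun w z => l w * l' z) = l (riesz A l').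
Proof.
move=> ll; rewrite trgE (row_scalarE _ _ ll); apply: eq_bigr => i _.
rewrite /riesz mxE mulr_suml; apply: eq_bigr => j _.
by rewrite mxE /=; ring.
Qed.

Lemma kulkarni_nomizuZr (c : R) P Q u1 u2 u3 u4 :
  kulkarni_nomizu P (fun u v => c * Q u v) u1 u2 u3 u4 =
  c * kulkarni_nomizu P Q u1 u2 u3 u4.
Proof. by rewrite /kulkarni_nomizu; ring. Qed.

(** Two of the four summands keep both contracted slots in one factor and give traces. The other two
    split them between the factors, where [trg_prod] applies. *)
Lemma contract14_kulkarni_nomizu A P Q u v :
  (forall v, scalar (P^~ v)) -> (forall v, scalar (Q^~ v)) ->
  contract14 A (kulkarni_nomizu P Q) u v =
  trg A P * Q u v + trg A Q * P u v
  - P (riesz A (Q u)) v - Q (riesz A (P u)) v.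
Proof.
move=> Pl Ql; rewrite /contract14 /kulkarni_nomizu.
rewrite [LHS](_ : _ = trg A (fun w z => Q u v * P w z + P u v * Q w z
   + (-1) * (P w v * Q u z) + (-1) * (Q w v * P u z))); last first.
  by congr (trg A _); apply/funext => w; apply/funext => z; ring.
by rewrite !trgD !trgZ !trg_prod//; ring.
Qed.

(** Inside the trace, [riesz] raises the index that [gform] has lowered. *)
Lemma contract14_gform A (L : V -> V -> V -> V) u v : A \in unitmx ->
  contract14 A (fun w u v z => gform A (L w u v) z) u v =
  \tr (lin1_mx (fun w => L w u v)).
Proof.
move=> uA; rewrite /contract14 /trg; congr (\tr _).
by apply/matrixP => i j; rewrite !mxE -[in RHS](riesz_gform _ (L _ _ _) uA) !mxE.
Qed.

(* Koszul's formula for constant vector fields, [D u] being the derivative of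
   the Gram matrix along [u] and [B] its inverse. *)
Definition koszul (D : V -> 'M[R]_n) (B : 'M[R]_n) (u v : V) : V :=
  (2^-1 *: \row_k (gform (D u) v 'e_k + gform (D v) u 'e_k
                   - gform (D 'e_k) u v)) *m B.

Lemma koszul_linearl D (B : 'M[R]_n) v : linear D -> linear (fun u => koszul D B u v).
Proof.
move=> Dl a u u'; rewrite /koszul scalemxAl -mulmxDl; congr (_ *m _).
by apply/rowP => k; rewrite !mxE Dl gformPm !gformPl; ring.
Qed.

Lemma koszul_linearr D (B : 'M[R]_n) u : linear D -> linear (koszul D B u).
Proof.
move=> Dl a v v'; rewrite /koszul scalemxAl -mulmxDl; congr (_ *m _).
by apply/rowP => k; rewrite !mxE Dl gformPm gformPl gformPr; ring.
Qed.

End Contraction.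

(** * Differentiability of matrix-valued maps *)

Section Differentiability.
Context {R : realType} {V W : normedModType R}.
Local Open Scope classical_set_scope.

Lemma differentiable_mx m n (f : V -> 'M[R]_(m, n)) x :
  (forall i j, differentiable (fun y => f y i j) x) -> differentiable f x.
Proof.
move=> df.
have -> : f = \sum_i \sum_j ((fun y => f y i j *: delta_mx i j) : V -> 'M[R]_(m, n)).
  apply/funext => y; rewrite {1}[f y]matrix_sum_delta fct_sumE.
  by apply: eq_bigr => i _; rewrite fct_sumE.
by do 2![apply: differentiable_sum => ?]; exact: differentiableZl.
Qed.

Lemma differentiable_entry m n (f : V -> 'M[R]_(m, n)) x i j :
  differentiable f x -> differentiable (fun y => f y i j) x.
Proof. by move=> df; exact: (differentiable_comp df (differentiable_coord _ _ _)). Qed.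

Lemma differentiable_prod n (f : 'I_n -> V -> R) x :
  (forall i, differentiable (f i) x) -> differentiable (\prod_(i < n) f i) x.
Proof.
by elim/big_ind : _ => // ? ? g h ?; apply: differentiableM; [exact: g|exact: h].
Qed.

Lemma differentiable_mulmx m n p (f : V -> 'M[R]_(m, n)) (g : V -> 'M[R]_(n, p)) x :
  differentiable f x -> differentiable g x ->
  differentiable (fun y => f y *m g y) x.
Proof.
move=> df dg; apply: differentiable_mx => i j.
have -> : (fun y => (f y *m g y) i j) =
          \sum_k ((fun y => f y i k) * (fun y => g y k j)).
  by apply/funext => y; rewrite mxE fct_sumE.
apply: differentiable_sum => k.
by apply: differentiableM; exact: differentiable_entry.
Qed.

Lemma differentiable_gform n (f : V -> 'M[R]_n) u v y :
  differentiable f y -> differentiable (fun z => gform (f z) u v) y.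
Proof.
move=> df; apply: differentiable_entry.
apply: differentiable_mulmx; last exact: differentiable_cst.
by apply: differentiable_mulmx => //; exact: differentiable_cst.
Qed.

(** By the Leibniz expansion the determinant is a polynomial in the entries. *)
Lemma differentiable_det n (f : V -> 'M[R]_n) x :
  differentiable f x -> differentiable (fun y => \det (f y)) x.
Proof.
move=> df.
have -> : (fun y => \det (f y)) =
          \sum_(s : 'S_n) ((-1) ^+ s *: \prod_i (fun y => f y i (s i))).
  apply/funext => y; rewrite fct_sumE.
  by apply: eq_bigr => s _; rewrite /= fct_prodE.
elim/big_ind : _ => [|g h|s _]; first exact: differentiable_cst.
  exact: differentiableD.
apply: differentiableZ; apply: differentiable_prod => i.
exact: differentiable_entry.
Qed.

(** Each entry is a signed minor times the inverse of a determinant that is nonzero at [x]. *)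
Lemma differentiable_invmx_adj n (f : V -> 'M[R]_n) x :
  f x \in unitmx -> differentiable f x ->
  differentiable (fun y => (\det (f y))^-1 *: \adj (f y)) x.
Proof.
rewrite unitmxE unitfE => det_neq0 df; apply: differentiable_mx => i j.
have -> : (fun y => ((\det (f y))^-1 *: \adj (f y)) i j) =
          (fun y => (\det (f y))^-1) *
          ((-1) ^+ (j + i) *: (fun y => \det (row' j (col' i (f y))))).
  by apply/funext => y; rewrite !mxE.
apply: differentiableM.
  by apply: differentiableV => //; exact: differentiable_det.
apply/differentiableZ/differentiable_det/differentiable_mx => k l.
rewrite (_ : (fun y => _) = fun y => f y (lift j k) (lift i l)).
  exact: differentiable_entry.
by apply/funext => y; rewrite !mxE.
Qed.

Lemma derive_linear (f : V -> W) x :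
  differentiable f x -> linear (fun u => 'D_u f x).
Proof. by move=> df a u u'; rewrite !deriveE// linearP. Qed.

End Differentiability.

(** * Christoffel symbols, curvature and its contractions in a chart *)

Section Curvature.
Context {R : realType} {n : nat}.
Local Notation V := 'rV[R]_n.
Variables (G : V -> 'M[R]_n) (U : set V).
Hypothesis openU : open U.
Hypothesis smoothG : smooth_on U G.
Hypothesis unitG : forall y, U y -> G y \in unitmx.
Local Open Scope classical_set_scope.

Let near_U x : U x -> \forall y \near x, U y.
Proof. by move=> Ux; exact: open_nbhs_nbhs. Qed.

Let differentiable_G y : U y -> differentiable G y.
Proof. exact: (proj1 (smoothG 1%N)). Qed.

Let differentiable_DG v y : U y -> differentiable (fun z => 'D_v G z) y.
Proof. by move: y; exact: (proj1 (proj2 (smoothG 2%N) v)). Qed.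

(** For fixed [u] and [v], [gform] is a linear combination of the Gram entries with constant
    coefficients. *)
Lemma derive_gform u v w y : U y ->
  'D_w (fun z => gform (G z) u v) y = gform ('D_w G y) u v.
Proof.
move=> Uy; have dG := differentiable_G _ Uy.
have dentry i j : derivable (fun z => G z i j) y w.
  exact/diff_derivable/differentiable_entry.
have -> : (fun z => gform (G z) u v) =
    \sum_i \sum_j ((u 0 i * v 0 j) *: (fun z => G z i j)).
  apply/funext => z; rewrite gformE fct_sumE.
  by apply: eq_bigr => i _; rewrite fct_sumE.
rewrite gformE derive_sum => [|i]; last first.
  by apply: derivable_sum => j; exact: derivableZ.
apply: eq_bigr => i _; rewrite derive_sum => [|j]; last exact: derivableZ.
apply: eq_bigr => j _; rewrite deriveZ//; congr (_ * _).
by rewrite derive_mx ?mxE//; exact: diff_derivable.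
Qed.

(* [christoffel G] on [U], where the inverse Gram matrix is written with
   Cramer's rule so that the formula is differentiable without having to
   discuss the junk value of [invmx] at singular matrices. *)
Definition christoffel_adj (u v y : V) : V :=
  koszul (fun w => 'D_w G y) ((\det (G y))^-1 *: \adj (G y)) u v.

Lemma christoffelE u v y : U y -> christoffel G y u v = christoffel_adj u v y.
Proof.
(* [invmx] is a conditional; [unitG] selects its Cramer branch. *)
move=> Uy; rewrite /christoffel /riesz /invmx unitG//; congr (_ *m _).
by apply/rowP => k; rewrite !mxE !derive_gform.
Qed.

Lemma christoffel_adj_linearl v y : U y -> linear (fun u => christoffel_adj u v y).
Proof. by move=> Uy; exact/koszul_linearl/derive_linear/differentiable_G. Qed.

Lemma christoffel_adj_linearr u y : U y -> linear (fun v => christoffel_adj u v y).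
Proof. by move=> Uy; exact/koszul_linearr/derive_linear/differentiable_G. Qed.

Lemma differentiable_christoffel_adj u v y :
  U y -> differentiable (christoffel_adj u v) y.
Proof.
move=> Uy; apply: differentiable_mulmx; last first.
  by apply: differentiable_invmx_adj; [exact: unitG|exact: differentiable_G].
apply/differentiableZ/differentiable_mx => i k.
rewrite (_ : (fun z => _) = (fun z => gform ('D_u G z) v 'e_k)
   + (fun z => gform ('D_v G z) u 'e_k) - (fun z => gform ('D_('e_k) G z) u v)).
  by apply: differentiableB; first apply: differentiableD;
    apply: differentiable_gform; exact: differentiable_DG.
by apply/funext => z; rewrite mxE.
Qed.

(** For constant fields the bracket vanishes and covariant derivatives are Christoffel vectors,
    leaving the classical $\partial\Gamma+\Gamma\Gamma$ formula. *)
Lemma curvature_atE x z u v : U x ->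
  curvature_at G x z u v =
  'D_z (christoffel_adj u v) x + christoffel_adj z (christoffel_adj u v x) x
  - ('D_u (christoffel_adj z v) x + christoffel_adj u (christoffel_adj z v x) x).
Proof.
move=> Ux; rewrite /curvature_at /curvature_operator.
have nablaE a b y : U y -> nabla G (cst a) (cst b) y = christoffel_adj a b y.
  by move=> Uy; rewrite /nabla derive_cst add0r christoffelE.
have nabla2E a b c : nabla G (cst a) (nabla G (cst b) (cst c)) x =
    'D_a (christoffel_adj b c) x + christoffel_adj a (christoffel_adj b c x) x.
  rewrite -(nablaE b c x Ux) -(christoffelE _ _ _ Ux).
  (* The inner [nabla] is rewritten only on [U]; this suffices because [U] is a neighbourhood of
     [x]. *)
  apply: (congr2 +%R _ erefl); apply: near_eq_derive.
  by apply: filterS (near_U _ Ux) => y; exact: nablaE.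
rewrite !nabla2E; set c := (X in _ - X = _); suff -> : c = 0 by rewrite subr0.
rewrite /c /nabla /lie_bracket /= derive_cst christoffelE// !derive_cst subrr add0r.
(* What is left of [c] is [christoffel_adj 0 v x]; linearity with coefficient [-1] at zero vectors
   shows that it is zero. *)
have := christoffel_adj_linearl v _ Ux (-1) 0 0.
by rewrite scaler0 addr0 scaleN1r addNr.
Qed.

(** The linearity identity holds throughout [U], hence near [x], and can be differentiated there. *)
Let derive_christoffel_adj_linearl x w v : U x ->
  linear (fun u => 'D_w (christoffel_adj u v) x).
Proof.
move=> Ux a u u'.
have dv b : derivable (christoffel_adj b v) x w.
  exact/diff_derivable/differentiable_christoffel_adj.
rewrite -deriveZ// -deriveD//; last exact: derivableZ.
apply: near_eq_derive; apply: filterS (near_U _ Ux) => y Uy.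
exact: (christoffel_adj_linearl _ _ Uy a u u').
Qed.

Let derive_christoffel_adj_linearr x w u : U x ->
  linear (fun v => 'D_w (christoffel_adj u v) x).
Proof.
move=> Ux a v v'.
have dv b : derivable (christoffel_adj u b) x w.
  exact/diff_derivable/differentiable_christoffel_adj.
rewrite -deriveZ// -deriveD//; last exact: derivableZ.
apply: near_eq_derive; apply: filterS (near_U _ Ux) => y Uy.
exact: (christoffel_adj_linearr _ _ Uy a v v').
Qed.

Lemma curvature_at_linearm x z v : U x -> linear (fun u => curvature_at G x z u v).
Proof.
move=> Ux; rewrite (funext (fun u => curvature_atE x z u v Ux)).
apply: linear_subfun; apply: linear_addfun.
- exact: derive_christoffel_adj_linearl.
- move=> a u u'; rewrite (christoffel_adj_linearl v x Ux a u u').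
  exact: (christoffel_adj_linearr _ _ Ux).
- exact/derive_linear/differentiable_christoffel_adj.
- exact: christoffel_adj_linearl.
Qed.

Lemma curvature_at_linearr x z u : U x -> linear (curvature_at G x z u).
Proof.
move=> Ux; rewrite (funext (fun v => curvature_atE x z u v Ux)).
have chr2 c b : linear (fun v => christoffel_adj c (christoffel_adj b v x) x).
  move=> a v v'; rewrite (christoffel_adj_linearr b x Ux a v v').
  exact: (christoffel_adj_linearr _ _ Ux).
by apply: linear_subfun; apply: linear_addfun;
  first [exact: derive_christoffel_adj_linearr | exact: chr2].
Qed.

(** [lin1_mx] reads only the images of basis vectors, so a pointwise identity between plain
    functions passes to traces. *)
Let mxtrace_lin1_linear (f g h : V -> V) (a : R) :
  (forall z, f z = a *: g z + h z) ->
  \tr (lin1_mx f) = a * \tr (lin1_mx g) + \tr (lin1_mx h).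
Proof.
move=> fE; rewrite -mxtraceZ -mxtraceD; congr (\tr _).
by apply/matrixP => i j; rewrite !mxE fE !mxE.
Qed.

Lemma ricci_scalarl x v : U x -> scalar (fun u => ricci G x u v).
Proof.
by move=> Ux a u u'; apply: mxtrace_lin1_linear => z; exact: curvature_at_linearm.
Qed.

Lemma ricci_scalarr x u : U x -> scalar (ricci G x u).
Proof.
by move=> Ux a v v'; apply: mxtrace_lin1_linear => z; exact: curvature_at_linearr.
Qed.

Lemma contract14_riemann x u v : U x ->
  contract14 (G x) (riemann G x) u v = ricci G x u v.
Proof. by move=> Ux; rewrite /riemann contract14_gform// unitG. Qed.

(** The contractions of $R$, $g\wedge S$ and $g\wedge g$ are $S$, $(n-2)S+\kappa g$ and $2(n-1)g$;
    the coefficients in $C$ make them cancel. *)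
Lemma contract14_weyl x u v : (4 <= n)%N -> U x ->
  contract14 (G x) (weyl G x) u v = 0.
Proof.
move=> n4 Ux; have uG := unitG x Ux.
have natr_neq k : (k < n)%N -> n%:R - k%:R != 0 :> R.
  by move=> kn; rewrite subr_eq0 eqr_nat neq_ltn kn orbT.
have n1 : n%:R - 1 != 0 :> R by apply: (natr_neq 1%N); exact: leq_trans n4.
have n2 : n%:R - 2 != 0 :> R by apply: (natr_neq 2); exact: leq_trans n4.
have gl w : scalar (fun u => gform (G x) u w) by move=> a u' u''; exact: gformPl.
have Sl w := ricci_scalarl x w Ux.
transitivity (contract14 (G x) (riemann G x) u v
   + (- (1 / (n%:R - 2))) * contract14 (G x) (kulkarni_nomizu (gform (G x)) (ricci G x)) u v
   + scalar_curvature G x / (2 * (n%:R - 2) * (n%:R - 1)) *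
     contract14 (G x) (kulkarni_nomizu (gform (G x)) (gform (G x))) u v).
  rewrite /contract14 -!trgZ -!trgD; congr (trg _ _).
  by apply/funext => w; apply/funext => z; rewrite /weyl mulNr.
rewrite contract14_riemann// !contract14_kulkarni_nomizu// trg_gform//.
rewrite riesz_gform// gform_rieszE//; last exact: ricci_scalarr.
rewrite -/(scalar_curvature G x); field.
by apply/andP.
Qed.

(** Both mixed terms are [ricci2] by the definition of [ricci_operator]. *)
Lemma contract14_kulkarni_nomizu_ricci x u v : U x ->
  contract14 (G x) (kulkarni_nomizu (ricci G x) (ricci G x)) u v =
  2 * (scalar_curvature G x * ricci G x u v - ricci2 G x u v).
Proof.
move=> Ux; rewrite contract14_kulkarni_nomizu; try by move=> w; exact: ricci_scalarl.
by rewrite -addrA -opprD -!mulr2n -mulrnBl mulr_natl.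
Qed.

End Curvature.

Theorem theorem6p1 (R : realType) (n : nat) (hn : (4 <= n)%N)
    (M : manifold R n) (g : semi_riemannian_metric M)
    (hg : essentially_conformally_symmetric g)
    (F : M -> R) (hF : fundamental_function g F) :
  let tau : M -> R := fun p => (n%:R - 2) * F p in
  forall (p : M) (i : chart_index M), chart_dom i p ->
  forall u1 u2 u3 u4 : 'rV[R]_n,
    let x := chart i p in
    let gx := gform (g i x) in
    let S := ricci (g i) x in
    let S2 := ricci2 (g i) x in
    let kappa := scalar_curvature (g i) x in
    tau p * weyl (g i) x u1 u2 u3 u4
    = kulkarni_nomizu gx S2 u1 u2 u3 u4
      + (n%:R - 2) / 2 * kulkarni_nomizu S S u1 u2 u3 u4
      - kappa * kulkarni_nomizu gx S u1 u2 u3 u4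
      + (kappa ^+ 2 - trg (g i x) S2) / (2 * (n%:R - 1))
        * kulkarni_nomizu gx gx u1 u2 u3 u4.
Proof.
move=> tau p i ip u1 u2 u3 u4 x gx S S2 kappa.
have Ux : chart_codom i x by exists p.
have openU := @chart_codom_open _ _ M i.
have smoothG := @gram_smooth _ _ _ g i.
have unitG := @gram_nondegenerate _ _ _ g i.
have FC v1 v2 v3 v4 : F p * weyl (g i) x v1 v2 v3 v4 =
    1 / 2 * kulkarni_nomizu S S v1 v2 v3 v4 by exact: hF.
have S2E : S2 = fun u v => kappa * S u v.
  (* The goal becomes $\kappa S-S^2=0$, the form in which the contraction delivers it. *)
  apply/funext => u; apply/funext => v; apply/eqP; rewrite eq_sym -subr_eq0.
  have h : F p * contract14 (g i x) (weyl (g i) x) u v =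
      1 / 2 * contract14 (g i x) (kulkarni_nomizu S S) u v.
    rewrite /contract14 -!trgZ; congr (trg _ _).
    by apply/funext => w; apply/funext => z; exact: FC.
  move: h; rewrite (contract14_weyl _ _ openU smoothG unitG _ _ _ hn Ux).
  rewrite (contract14_kulkarni_nomizu_ricci _ _ openU smoothG unitG _ _ _ Ux).
  by rewrite mulr0 mulrA div1r mulVf ?pnatr_eq0// mul1r => <-.
have -> : trg (g i x) S2 = kappa ^+ 2.
  by rewrite S2E trgZ expr2.
(* The $g\wedge g$ coefficient is now zero, and $g\wedge S^2$ becomes $\kappa\,g\wedge S$, which
   cancels the third term. *)
rewrite subrr !mul0r addr0 -[tau p]/((n%:R - 2) * F p) -[LHS]mulrA FC S2E.
by rewrite kulkarni_nomizuZr addrAC subrr add0r mul1r mulrA.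
Qed.
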